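(* Let $n\ge 2$, let $S$ be a linear subspace of $\mathbb R^n$ of dimension $D$, and let $\xi=(\xi_1,\dots,\xi_n)$ be a random vector with independent coordinates. Let $\sigma>0$ and $c>0$, and assume that for every $i=1,\dots,n$, $$\log\mathbb E\big[e^{\lambda\xi_i}\big]\le\frac{\lambda^2\sigma^2}{2(1-|\lambda|c)}\qquad\text{for all }\lambda\in(-1/c,1/c).$$ Then, with $\kappa=18$, for all $x,u>0$, $$\mathbb P\Big[|\Pi_S\xi|_2^2\ge\kappa^2\Big(\sigma^2+\frac{2cu}{\kappa}\Big)(D+x),\ \ |\Pi_S\xi|_\infty\le u\Big]\le e^{-x}.$$ Moreover, for all $x>0$, $$\mathbb P\big(|\Pi_S\xi|_\infty\ge x\big)\le 2n\exp\Big[-\frac{x^2}{2\Lambda_2^2(S)(\sigma^2+cx)}\Big].$$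
   Context: $\Pi_S$ is the orthogonal projection of $\mathbb R^n$ onto $S$ for the Euclidean inner product $\langle\cdot,\cdot\rangle$. For $x\in\mathbb R^n$, $|x|_2=\sqrt{\langle x,x\rangle}$ and $|x|_\infty=\max_i|x_i|$. Let $e_1,\dots,e_n$ be the canonical basis of $\mathbb R^n$. Then $\Lambda_2(S)=\max_{i=1,\dots,n}|\Pi_Se_i|_2$. *)

(* Defs.v *)
From HB Require Import structures.
From mathcomp Require Import all_boot all_order all_algebra.
From mathcomp Require Import all_classical all_reals all_analysis.
Set Implicit Arguments. Unset Strict Implicit. Unset Printing Implicit Defensive.
Import Order.TTheory GRing.Theory Num.Theory.
Local Open Scope classical_set_scope.
Local Open Scope ring_scope.

Definition dotR {R : realType} {n : nat} (u v : 'rV[R]_n) : R :=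
  \sum_(i < n) u 0 i * v 0 i.

Definition norm2 {R : realType} {n : nat} (x : 'rV[R]_n) : R :=
  Num.sqrt (dotR x x).

Definition norminf {R : realType} {n : nat} (x : 'rV[R]_n) : R :=
  \big[Num.max/0]_(i < n) `|x 0 i|.

(* Orthogonal projection onto the row space S (a linear subspace of R^n,
   represented as a matrix whose row space is the subspace, as in mxalgebra):
   the (unique) y in S with x - y orthogonal to every vector of S. *)
Definition projS {R : realType} {m n : nat} (S : 'M[R]_(m, n)) (x : 'rV[R]_n)
  : 'rV[R]_n :=
  xget 0 [set y : 'rV[R]_n | (y <= S)%MS /\
     forall s : 'rV[R]_n, (s <= S)%MS -> dotR (x - y) s = 0].

Definition canon {R : realType} {n : nat} (i : 'I_n) : 'rV[R]_n := delta_mx 0 i.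

Definition Lambda2 {R : realType} {m n : nat} (S : 'M[R]_(m, n)) : R :=
  \big[Num.max/0]_(i < n) norm2 (projS S (canon i)).

(* Mutual independence of a finite family of real random variables:
   product rule for every family of Borel sets (taking B i = setT
   recovers every subfamily). *)
Definition mutually_independent {d : measure_display} {T : measurableType d}
  {R : realType} (P : probability T R) {n : nat} (X : 'I_n -> T -> R) : Prop :=
  forall B : 'I_n -> set R, (forall i, measurable (B i)) ->
    P (\bigcap_(i in [set: 'I_n]) (X i @^-1` B i)) =
    (\prod_(i < n) P (X i @^-1` B i))%E.

Definition rvec {T : Type} {R : realType} {n : nat} (X : 'I_n -> T -> R)
  (w : T) : 'rV[R]_n := \row_i X i w.

(* Main.v *)
Require Import Defs.
From HB Require Import structures.
From mathcomp Require Import all_boot all_order all_algebra.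
From mathcomp Require Import all_classical all_reals all_analysis.
From mathcomp Require Import measurable_realfun ring lra zify.
Set Implicit Arguments. Unset Strict Implicit. Unset Printing Implicit Defensive.
Import Order.TTheory GRing.Theory Num.Theory.
Local Open Scope classical_set_scope.
Local Open Scope ring_scope.

(* Since the sup norm is controlled on the event, no chaining is needed: one net suffices.
   Write Y for the projection of xi and z^2 for the threshold, so that
   z^2 = 36 (9 sigma^2 + c u) (D + x).  On the event, y = (z/|Y|_2) Y lies in the convex body
   K = {t in S : |t|_2 <= z, |t|_inf <= u} and <y, Y> = z |Y|_2.  K has a 1/2-net of
   at most 10^D points for its own gauge, and the net point t nearest to y satisfies
   <t, xi> = <t, Y> >= z^2 / 2.  Bernstein's inequality for each net point gives probability
   at most exp(-9 (D + x)), and 10^D exp(-9 (D + x)) <= exp(-x).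
   For the sup norm, Y_i = <P e_i, xi>, P being the projection, with |P e_i|_2 <= Lambda_2 and
   |P e_i|_inf <= Lambda_2^2, and Bernstein's inequality applies to the 2n vectors
   +- P e_i.

   The bound 10^D is obtained without volumes: p points of a unit ball at mutual distance
   > 1/2 yield, by iterated insertion of scaled copies, p^j points at mutual distance of
   order 10^-j, whereas a box-counting argument allows at most C^D 10^(D j) of them. *)

(** * Half-nets of unit balls *)

(** If [p] were at least q + 1, Bernoulli's inequality would give (q + j) q^j <= q (q + 1)^j <= q E
    q^j, which fails at j = E q + 1. A prefactor independent of [j] is thus harmless. *)
Lemma leq_of_expn_growth (p q E : nat) :
  (0 < q)%N -> (forall j, p ^ j <= E * q ^ j)%N -> (p <= q)%N.
Proof.
move=> q0 h; rewrite leqNgt; apply/negP => qp.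
have bernoulli j : ((q + j) * q ^ j <= q * q.+1 ^ j)%N.
  elim: j => [|j IH]; first by rewrite addn0.
  rewrite !expnS; apply: (@leq_trans (q.+1 * ((q + j) * q ^ j))).
    by rewrite !mulnA leq_mul2r; apply/orP; right; lia.
  by rewrite (mulnCA q) leq_mul2l IH orbT.
pose j := (E * q).+1.
have pj : (q.+1 ^ j <= p ^ j)%N by rewrite leq_exp2r.
have := leq_trans (bernoulli j) (leq_mul (leqnn q) (leq_trans pj (h j))).
by rewrite mulnA leq_pmul2r ?expn_gt0 ?q0 // /j; lia.
Qed.

Section packing.
Context (R : realType) (D : nat) (N : 'rV[R]_D -> R) (A : nat).
Context (N0 : N 0 = 0) (ND : forall a b, N (a + b) <= N a + N b)
  (NZ : forall k a, N (k *: a) = `|k| * N a) (A_gt0 : (0 < A)%N)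
  (N_le : forall (a : 'rV[R]_D) r, 0 <= r ->
    (forall i, `|a 0 i| <= r) -> N a <= A%:R * r)
  (le_N : forall (a : 'rV[R]_D) i, `|a 0 i| <= A%:R * N a).

(** The coordinates lie in [-5A/4, 5A/4]; cut this interval into cells of length 1/M = 10^-j / (8
    A). Two points with the same cell on every axis are at [N]-distance at most A / M = 10^-j / 8,
    below the separation 10^-j / 4, so the cell map is injective. *)
Lemma box_packing_bound (I : finType) (y : I -> 'rV[R]_D) (j : nat) :
  (forall i, N (y i) <= 5 / 4) ->
  (forall i k, i != k -> (10 ^ j)%:R^-1 / 4 <= N (y i - y k)) ->
  (#|I| <= (((20 * A ^ 2).+1) ^ D) * (10 ^ D) ^ j)%N.
Proof.
move=> y1 ysep.
(* Cell indices range up to (5/2) A M = 20 A^2 10^j inclusive; the [.+1] makes the bound strict. *)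
pose L := ((20 * A ^ 2).+1 * 10 ^ j)%N.
pose M : R := (8 * A * 10 ^ j)%:R.
have M0 : 0 < M by rewrite ltr0n !muln_gt0 A_gt0 expn_gt0.
pose v i k : R := (y i 0 k + 5 / 4 * A%:R) * M.
have v0 i k : 0 <= v i k.
  rewrite mulr_ge0 ?(ltW M0)//.
  have := le_N (y i) k; rewrite ler_norml => /andP[+ _].
  have : A%:R * N (y i) <= A%:R * (5 / 4) by rewrite ler_wpM2l.
  by lra.
have vL i k : (Num.truncn (v i k) < L)%N.
  rewrite truncn_lt_nat //.
  have h1 : y i 0 k + 5 / 4 * A%:R <= 5 / 2 * A%:R.
    have := le_N (y i) k; rewrite ler_norml => /andP[_].
    have : A%:R * N (y i) <= A%:R * (5 / 4) by rewrite ler_wpM2l.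
    by lra.
  have : v i k <= 5 / 2 * A%:R * M by rewrite ler_wpM2r // ltW.
  move=> /le_lt_trans; apply.
  have -> : 5 / 2 * A%:R * M = (20 * A ^ 2 * 10 ^ j)%:R.
    by rewrite /M !natrM !natrX; field.
  by rewrite ltr_nat /L ltn_pmul2r ?expn_gt0.
pose F i : {ffun 'I_D -> 'I_L} := [ffun k => Ordinal (vL i k)].
have Finj : injective F.
  move=> a b /ffunP Fab; apply/eqP/negPn/negP => ab.
  have d k : `|(y a - y b) 0 k| <= M^-1.
    have := Fab k; rewrite !ffunE => -[e].
    have /andP[a1 a2] := truncn_itv (v0 a k).
    have /andP[b1 b2] := truncn_itv (v0 b k).
    rewrite e in a1 a2.
    rewrite !mxE -[M^-1]mul1r ler_pdivlMr // -{1}(gtr0_norm M0) -normrM.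
    have -> : (y a 0 k - y b 0 k) * M = v a k - v b k by rewrite /v; ring.
    rewrite -natr1 in a2; rewrite -natr1 in b2.
    by rewrite ler_norml; apply/andP; split; lra.
  have := N_le (ltW _) d; rewrite invr_gt0 => /(_ M0) h.
  have := le_trans (ysep _ _ ab) h.
  have -> : A%:R * M^-1 = (10 ^ j)%:R^-1 / 8.
    rewrite /M !natrM; field.
    by rewrite !pnatr_eq0 -!lt0n expn_gt0 A_gt0.
  have : 0 < (10 ^ j)%:R^-1 :> R by rewrite invr_gt0 ltr0n expn_gt0.
  by lra.
have := leq_card F Finj.
by rewrite card_ffun !card_ord /L expnMn -!expnM (mulnC j).
Qed.

(* Inserting a copy of the family scaled by 1/10 at each of its points multiplies
   the cardinality by p and divides the separation by 10. *)
Lemma packing_iterate (p : nat) (x : 'I_p -> 'rV[R]_D) (j : nat) :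
  (forall i, N (x i) <= 1) ->
  (forall i k, i != k -> 1 / 2 < N (x i - x k)) ->
  exists (I : finType) (y : I -> 'rV[R]_D),
    [/\ #|I| = (p ^ j)%N, forall i, N (y i) <= 5 / 4 &
     forall i k, i != k -> (10 ^ j)%:R^-1 / 4 <= N (y i - y k)].
Proof.
move=> x1 xsep; elim: j => [|j [I [y [cI y1 ysep]]]].
  exists unit, (fun=> 0); split; first by rewrite card_unit.
  - by move=> _; rewrite N0; lra.
  - by move=> [] [].
exists ('I_p * I)%type, (fun ik => x ik.1 + 10^-1 *: y ik.2); split.
- by rewrite card_prod card_ord cI expnS.
(* The radius 5/4 is stable under insertion: 1 + (5/4)/10 <= 5/4. *)
- move=> [i k] /=; apply: le_trans (ND _ _) _; rewrite NZ gtr0_norm ?invr_gt0//.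
  by have := x1 i; have := y1 k; lra.
- move=> [i k] [i' k'] /= ne.
  have [ii|ii] := eqVneq i i'.
    have kk : k != k' by apply: contraNneq ne => ->; rewrite ii.
    have -> : x i + 10^-1 *: y k - (x i' + 10^-1 *: y k') = 10^-1 *: (y k - y k').
      by rewrite ii scalerBr opprD addrACA subrr add0r.
    rewrite NZ gtr0_norm ?invr_gt0// expnS natrM invfM.
    by have := ysep _ _ kk; lra.
  (* Copies around distinct centres have radius at most 1/8, so their points stay 1/2 - 1/8 - 1/8 =
     1/4 apart. *)
  have h1 := xsep _ _ ii.
  have h2 : N (x i - x i') <= N (x i + 10^-1 *: y k - (x i' + 10^-1 *: y k')) +
      (N (10^-1 *: y k') + N (- 10^-1 *: y k)).
    apply: le_trans (lerD (lexx _) (ND _ _)); apply: le_trans (ND _ _).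
    rewrite [X in _ <= N X](_ : _ = x i - x i') //.
    by apply/rowP => l; rewrite !mxE; ring.
  rewrite !NZ normrN gtr0_norm ?invr_gt0// in h2.
  have : (10 ^ j.+1)%:R^-1 <= 10^-1 :> R.
    rewrite lef_pV2 ?posrE ?ltr0n ?expn_gt0//.
    by rewrite ler_nat -[leqLHS]expn1 leq_exp2l.
  by have := y1 k; have := y1 k'; lra.
Qed.

(** Iteration and box counting give p^j <= (20 A^2 + 1)^D (10^D)^j for all [j]. The comparison
    constant [A] enters only the prefactor, so a crude [A] costs nothing. *)
Lemma packing_bound (p : nat) (x : 'I_p -> 'rV[R]_D) :
  (forall i, N (x i) <= 1) ->
  (forall i k, i != k -> 1 / 2 < N (x i - x k)) -> (p <= 10 ^ D)%N.
Proof.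
move=> x1 xsep; apply: (@leq_of_expn_growth _ _ ((20 * A ^ 2).+1 ^ D)).
  by rewrite expn_gt0.
move=> j; have [I [y [<- y1 ysep]]] := packing_iterate j x1 xsep.
exact: box_packing_bound.
Qed.

(** The net is a 1/2-separated family of maximal length in the unit ball; the packing bound caps the
    lengths, so a maximum exists. A point farther than 1/2 from every member could be prepended,
    against maximality. *)
Lemma exists_half_net : exists s : seq 'rV[R]_D,
  [/\ (size s <= 10 ^ D)%N, forall a, a \in s -> N a <= 1 &
   forall a, N a <= 1 -> exists2 b, b \in s & N (a - b) <= 1 / 2].
Proof.
pose Q s := all (fun a => N a <= 1) s && pairwise (fun a b => 1 / 2 < N (a - b)) s.
have NC a b : N (a - b) = N (b - a).
  by rewrite -[a - b]opprB -scaleN1r NZ normrN1 mul1r.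
have Qsize s : Q s -> (size s <= 10 ^ D)%N.
  move=> /andP[/allP s1 /pairwiseP ss].
  apply: (@packing_bound _ (fun i => nth 0 s i)) => [i|i k ik].
    by apply/s1/mem_nth.
  have [lt|lt|/val_inj e] := ltngtP i k; last by rewrite e eqxx in ik.
    by apply: ss lt; rewrite inE.
  by rewrite NC; apply: ss lt; rewrite inE.
pose B n := `[< exists2 s, Q s & size s = n >].
have B0 : exists n, B n by exists 0%N; apply/asboolP; exists [::].
have Bub n : B n -> (n <= 10 ^ D)%N by move=> /asboolP[s /Qsize + <-].
have [k /asboolP[s Qs ks] kmax] := ex_maxnP B0 Bub.
exists s; split; first exact: Qsize.
  by case/andP: Qs => /allP.
move=> a a1; apply: contrapT => nos.
suff /kmax : B k.+1 by rewrite ltnn.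
apply/asboolP; exists (a :: s); last by rewrite /= ks.
rewrite /Q /= a1 /=; case/andP: Qs => -> ->; rewrite andbT /=.
by apply/allP => b bs; rewrite ltNge; apply/negP => ab; apply: nos; exists b.
Qed.

End packing.

(** * Orthogonal projection *)

Section euclidean.
Context {R : realType} {n : nat}.
Implicit Types (u v w : 'rV[R]_n) (k : R).

Lemma dotR_mulmx u v : dotR u v = (u *m v^T) 0 0.
Proof. by rewrite mxE; apply: eq_bigr => i _; rewrite mxE. Qed.

Lemma dotRC u v : dotR u v = dotR v u.
Proof. by apply: eq_bigr => i _; rewrite mulrC. Qed.

Lemma dotRDl u v w : dotR (u + v) w = dotR u w + dotR v w.
Proof. by rewrite !dotR_mulmx mulmxDl mxE. Qed.

Lemma dotRDr u v w : dotR w (u + v) = dotR w u + dotR w v.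
Proof. by rewrite dotRC dotRDl !(dotRC w). Qed.

Lemma dotRZl k u v : dotR (k *: u) v = k * dotR u v.
Proof. by rewrite !dotR_mulmx -scalemxAl mxE. Qed.

Lemma dotRZr k u v : dotR v (k *: u) = k * dotR v u.
Proof. by rewrite dotRC dotRZl dotRC. Qed.

Lemma dotRNl u v : dotR (- u) v = - dotR u v.
Proof. by rewrite -scaleN1r dotRZl mulN1r. Qed.

Lemma dotRBl u v w : dotR (u - v) w = dotR u w - dotR v w.
Proof. by rewrite dotRDl dotRNl. Qed.

Lemma dotRBr u v w : dotR w (u - v) = dotR w u - dotR w v.
Proof. by rewrite dotRC dotRBl !(dotRC w). Qed.

Lemma dotR0l v : dotR 0 v = 0.
Proof. by rewrite -(scale0r 0) dotRZl mul0r. Qed.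

Lemma dotR_ge0 u : 0 <= dotR u u.
Proof. by apply: sumr_ge0 => i _; rewrite -expr2 sqr_ge0. Qed.

Lemma dotR_eq0 u : dotR u u = 0 -> u = 0.
Proof.
move=> /eqP; rewrite psumr_eq0 => [/allP u0|i _]; last by rewrite -expr2 sqr_ge0.
apply/rowP => i; rewrite mxE; apply/eqP.
by have := u0 i (mem_index_enum i); rewrite mulf_eq0 orbb.
Qed.

Lemma dotR_canon u (i : 'I_n) : dotR u (Defs.canon i) = u 0 i.
Proof.
rewrite /dotR (bigD1 i) //= big1 => [|j ji]; rewrite !mxE eqxx ?eqxx /=.
  by rewrite addr0 mulr1.
by rewrite (negbTE ji) mulr0.
Qed.

Lemma norm2_ge0 u : 0 <= norm2 u.
Proof. exact: sqrtr_ge0. Qed.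

Lemma sqr_norm2 u : norm2 u ^+ 2 = dotR u u.
Proof. by rewrite sqr_sqrtr ?dotR_ge0. Qed.

Lemma dotR_le_norm2 u v : dotR u v <= norm2 u * norm2 v.
Proof.
have [v0|v0] := eqVneq (dotR v v) 0.
  by rewrite (dotR_eq0 v0) dotRC dotR0l mulr_ge0 ?norm2_ge0.
have vpos : 0 < dotR v v by rewrite lt_neqAle eq_sym v0 dotR_ge0.
(* This product is the squared norm of <v,v> u - <u,v> v, a multiple of the part of [u] orthogonal
   to [v]. *)
have : 0 <= dotR v v * (dotR u u * dotR v v - dotR u v ^+ 2).
  have := dotR_ge0 (dotR v v *: u - dotR u v *: v).
  rewrite dotRBl !dotRBr !dotRZl !dotRZr (dotRC v u) => /le_trans; apply.
  by rewrite le_eqVlt; apply/orP; left; apply/eqP; ring.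
rewrite pmulr_rge0 // subr_ge0 -!sqr_norm2 -exprMn => h.
apply: le_trans (ler_norm _) _.
by rewrite -ler_sqr ?nnegrE ?mulr_ge0 ?norm2_ge0 // real_normK ?num_real.
Qed.

Lemma norm2D u v : norm2 (u + v) <= norm2 u + norm2 v.
Proof.
rewrite -ler_sqr ?nnegrE ?addr_ge0 ?norm2_ge0 // sqr_norm2 dotRDl !dotRDr.
rewrite sqrrD !sqr_norm2 (dotRC v u).
by have := dotR_le_norm2 u v; lra.
Qed.

Lemma norm2Z k u : norm2 (k *: u) = `|k| * norm2 u.
Proof.
by rewrite /norm2 dotRZl dotRZr mulrA -expr2 sqrtrM ?sqr_ge0 // sqrtr_sqr.
Qed.

Lemma norm2N u : norm2 (- u) = norm2 u.
Proof. by rewrite -scaleN1r norm2Z normrN1 mul1r. Qed.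

Lemma norminf_ge0 u : 0 <= norminf u.
Proof. by apply: bigmax_ge_id. Qed.

Lemma le_norminf u i : `|u 0 i| <= norminf u.
Proof. exact: (le_bigmax _ (fun i => `|u 0 i|)). Qed.

Lemma norminf_le u r : 0 <= r -> (forall i, `|u 0 i| <= r) -> norminf u <= r.
Proof. by move=> r0 h; apply/bigmax_leP; split. Qed.

Lemma norminfD u v : norminf (u + v) <= norminf u + norminf v.
Proof.
apply: norminf_le => [|i]; first by rewrite addr_ge0 ?norminf_ge0.
by rewrite mxE (le_trans (ler_normD _ _)) // lerD ?le_norminf.
Qed.

Lemma norminfZ k u : norminf (k *: u) = `|k| * norminf u.
Proof.
apply/le_anti/andP; split.
  apply: norminf_le => [|i]; first by rewrite mulr_ge0 ?norminf_ge0.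
  by rewrite mxE normrM ler_wpM2l ?le_norminf.
have [->|k0] := eqVneq k 0; first by rewrite normr0 mul0r norminf_ge0.
have k1 : 0 < `|k| by rewrite normr_gt0.
rewrite mulrC -ler_pdivlMr //; apply: norminf_le => [|i].
  by rewrite divr_ge0 ?norminf_ge0.
rewrite ler_pdivlMr // mulrC -normrM.
by have := le_norminf (k *: u) i; rewrite mxE.
Qed.

Lemma norm2_le_norminf u : norm2 u <= n%:R * norminf u.
Proof.
rewrite -ler_sqr ?nnegrE ?mulr_ge0 ?norm2_ge0 ?norminf_ge0 // sqr_norm2.
apply: (@le_trans _ _ (\sum_(i < n) norminf u ^+ 2)).
  by apply: ler_sum => i _; rewrite -expr2 -real_normK ?num_real //
     lerXn2r ?nnegrE ?norminf_ge0 ?le_norminf.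
rewrite sumr_const card_ord -[leLHS]mulr_natl exprMn ler_wpM2r ?sqr_ge0 //.
by rewrite -natrX ler_nat; case: n => // k; rewrite expnS leq_pmulr ?expn_gt0.
Qed.

End euclidean.

Section projection.
Context {R : realType} {m n : nat} (S : 'M[R]_(m, n)).
Implicit Types x s : 'rV[R]_n.

(* With the rows of B a basis of S, the projection is given by the normal equations:
   x B^T (B B^T)^-1 B. *)
Let B := row_base S.
Let Q := B^T *m invmx (B *m B^T) *m B.

(** A vector [v] in the left kernel of the Gram matrix satisfies |v B|^2 = v B B^T v^T = 0, hence v
    B = 0, and [B] has a right inverse. *)
Let gram_unit : B *m B^T \in unitmx.
Proof.
rewrite -row_free_unit -kermx_eq0; apply/eqP/row_matrixP => i; rewrite row0.
set v := row i _.
have vG : v *m (B *m B^T) = 0 by apply/sub_kermxP; rewrite row_sub.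
have : dotR (v *m B) (v *m B) = 0.
  by rewrite dotR_mulmx trmx_mul mulmxA -(mulmxA v) vG mul0mx mxE.
move/dotR_eq0 => vB; have /row_freeP[B' BB'] := row_base_free S.
by rewrite -[v]mulmx1 -BB' mulmxA -/B vB mul0mx.
Qed.

Let mul_projmx_sub x : (x *m Q <= S)%MS.
Proof.
have BS : (B <= S)%MS by rewrite eq_row_base.
by rewrite /Q mulmxA; apply: submx_trans BS; exact: submxMl.
Qed.

Let mul_projmx_orth x s : (s <= S)%MS -> dotR (x - x *m Q) s = 0.
Proof.
move=> sS; have /submxP[a ->] : (s <= B)%MS by rewrite /B eq_row_base.
rewrite dotR_mulmx trmx_mul mulmxBl !(mulmxA _ B^T a^T) /Q.
suff -> : x *m (B^T *m invmx (B *m B^T) *m B) *m B^T = x *m B^T by rewrite subrr mxE.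
by rewrite -[LHS]mulmxA -(mulmxA _ B) -(mulmxA B^T) mulVmx // mulmx1.
Qed.

(** The difference of two candidates lies in [S] and is orthogonal to [S], hence to itself. The
    candidate [y] also rules out the default value of [xget]. *)
Lemma projSE x y : (y <= S)%MS ->
  (forall s, (s <= S)%MS -> dotR (x - y) s = 0) -> projS S x = y.
Proof.
move=> yS yo; rewrite /projS; case: xgetP => [z _ [zS zo]|/(_ y)[]//].
apply/eqP; rewrite -subr_eq0; apply/eqP/dotR_eq0.
have zyS : (z - y <= S)%MS by rewrite addmx_sub // eqmx_opp.
rewrite -[X in dotR X](_ : (x - y) - (x - z) = _); last by rewrite opprB addrC subrKA.
by rewrite dotRBl yo // zo // subrr.
Qed.

Lemma projS_sub x : (projS S x <= S)%MS.
Proof.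
by rewrite (@projSE x (x *m Q)) ?mul_projmx_sub // => s; exact: mul_projmx_orth.
Qed.

Lemma dotR_projSl x s : (s <= S)%MS -> dotR (projS S x) s = dotR x s.
Proof.
move=> sS; rewrite (@projSE x (x *m Q)) ?mul_projmx_sub //.
  by apply/esym/eqP; rewrite -subr_eq0 -dotRBl mul_projmx_orth.
by move=> t; exact: mul_projmx_orth.
Qed.

(** Both sides equal the inner product of the two projections. *)
Lemma projS_selfadjoint x y : dotR (projS S x) y = dotR x (projS S y).
Proof.
by rewrite -(dotR_projSl _ (projS_sub y)) dotRC -(dotR_projSl _ (projS_sub x)) dotRC.
Qed.

Lemma norm2_projS_canon_le_Lambda2 (i : 'I_n) : norm2 (projS S (Defs.canon i)) <= Lambda2 S.
Proof. exact: (le_bigmax _ (fun i => norm2 (projS S (Defs.canon i)))). Qed.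

Lemma Lambda2_ge0 : 0 <= Lambda2 S.
Proof. exact: bigmax_ge_id. Qed.

(* The entries of the projection are <P e_i, P e_j>, hence the square. *)
Lemma projS_canon_entry_le (i j : 'I_n) : `|projS S (Defs.canon i) 0 j| <= Lambda2 S ^+ 2.
Proof.
have h a b : norm2 a <= Lambda2 S -> norm2 b <= Lambda2 S -> dotR a b <= Lambda2 S ^+ 2.
  move=> ha hb; apply: le_trans (dotR_le_norm2 _ _) _.
  by rewrite expr2 ler_pM ?norm2_ge0.
have -> : projS S (Defs.canon i) 0 j = dotR (projS S (Defs.canon i)) (projS S (Defs.canon j)).
  by rewrite [RHS]dotRC dotR_projSl ?projS_sub // dotRC dotR_canon.
rewrite ler_norml; apply/andP; split; last by rewrite h ?norm2_projS_canon_le_Lambda2.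
by rewrite lerNl -dotRNl h ?norm2N ?norm2_projS_canon_le_Lambda2.
Qed.

End projection.


(** * Half-nets of the convex bodies |t|_2 <= z, |t|_inf <= u in a subspace *)

Lemma norminf_mulmx_le (R : realType) (p q : nat) (a : 'rV[R]_p) (B : 'M[R]_(p, q)) :
  norminf (a *m B) <= (\sum_i \sum_j `|B i j|) * norminf a.
Proof.
have B0 i : 0 <= \sum_j `|B i j| by apply: sumr_ge0.
apply: norminf_le => [|j]; first by rewrite mulr_ge0 ?norminf_ge0 // sumr_ge0.
rewrite mxE mulr_suml; apply: le_trans (ler_norm_sum _ _ _) _.
apply: ler_sum => i _; rewrite normrM mulrC ler_pM ?le_norminf //.
by rewrite (bigD1 j) //= lerDl sumr_ge0.
Qed.

(** In coordinates with respect to a row basis of [S], the body is the unit ball of the norm [N]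
    below, on a space of dimension [\rank S]; its half-net is carried back by multiplication with
    the basis. *)
Lemma subspace_half_net (R : realType) (m n : nat) (S : 'M[R]_(m, n)) (z u : R) :
  0 < z -> 0 < u -> exists s : seq 'rV[R]_n,
  [/\ (size s <= 10 ^ \rank S)%N,
      forall t, t \in s -> [/\ (t <= S)%MS, norm2 t <= z & norminf t <= u] &
      forall y, (y <= S)%MS -> norm2 y <= z -> norminf y <= u ->
        exists2 t, t \in s & norm2 (y - t) <= z / 2].
Proof.
move=> z0 u0; pose B := row_base S.
have /row_freeP[B' BB'] := row_base_free S.
pose N (a : 'rV[R]_(\rank S)) := Num.max (norm2 (a *m B) / z) (norminf (a *m B) / u).
have NE a r : (N a <= r) = (norm2 (a *m B) <= r * z) && (norminf (a *m B) <= r * u).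
  by rewrite ge_max !ler_pdivrMr.
have Nle a : norm2 (a *m B) <= N a * z /\ norminf (a *m B) <= N a * u.
  by apply/andP; rewrite -NE lexx.
have N00 a : 0 <= N a by rewrite le_max divr_ge0 ?norm2_ge0 ?(ltW z0).
have NZle k a : N (k *: a) <= `|k| * N a.
  have [h1 h2] := Nle a.
  by rewrite NE -scalemxAl norm2Z norminfZ -!mulrA !ler_wpM2l ?normr_ge0.
have NZ k a : N (k *: a) = `|k| * N a.
  apply/le_anti; rewrite NZle /=.
  have [->|k0] := eqVneq k 0; first by rewrite normr0 mul0r.
  rewrite -ler_pdivlMl ?normr_gt0 // -normfV.
  by rewrite -{1}[a](scalerK k0) NZle.
have ND a b : N (a + b) <= N a + N b.
  have [h1 h2] := Nle a; have [h3 h4] := Nle b.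
  rewrite NE mulmxDl !mulrDl.
  by rewrite (le_trans (norm2D _ _)) ?(le_trans (norminfD _ _)) // lerD.
have N0 : N 0 = 0 by rewrite -(scale0r 0) NZ normr0 mul0r.
pose b := \sum_i \sum_j `|B i j|; pose b' := \sum_i \sum_j `|B' i j|.
have b0 : 0 <= b by apply: sumr_ge0 => i _; apply: sumr_ge0.
have b'0 : 0 <= b' by apply: sumr_ge0 => i _; apply: sumr_ge0.
have e1 : 0 <= n%:R * b / z by rewrite divr_ge0 ?mulr_ge0 // ltW.
have e2 : 0 <= b / u by rewrite divr_ge0 // ltW.
have e3 : 0 <= b' * u by rewrite mulr_ge0 // ltW.
(* The first two terms bound [N] by the sup norm of the coordinates, through its Euclidean and sup
   parts; the third bounds the coordinates by [N], through the right inverse [B']. *)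
pose A := (Num.truncn (n%:R * b / z + b / u + b' * u)).+1.
have AE : n%:R * b / z + b / u + b' * u <= A%:R.
  by rewrite ltW // truncnS_gt.
have N_le (a : 'rV[R]_(\rank S)) r : 0 <= r -> (forall i, `|a 0 i| <= r) -> N a <= A%:R * r.
  move=> r0 ar; have ar' := norminf_le r0 ar.
  have h : norminf (a *m B) <= b * r.
    by apply: le_trans (norminf_mulmx_le _ _) _; rewrite ler_wpM2l.
  rewrite ge_max; apply/andP; split.
    apply: (@le_trans _ _ (n%:R * b / z * r)); last by rewrite ler_wpM2r //; lra.
    rewrite ler_pdivrMr // mulrAC divfK ?gt_eqF //.
    apply: le_trans (norm2_le_norminf _) _.
    by rewrite -mulrA ler_wpM2l.
  apply: (@le_trans _ _ (b / u * r)); last by rewrite ler_wpM2r //; lra.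
  by rewrite ler_pdivrMr // mulrAC divfK ?gt_eqF.
have le_N (a : 'rV[R]_(\rank S)) i : `|a 0 i| <= A%:R * N a.
  apply: le_trans (le_norminf a i) _.
  rewrite -{1}[a]mulmx1 -BB' mulmxA -/B.
  apply: le_trans (norminf_mulmx_le _ _) _; rewrite -/b'.
  apply: (@le_trans _ _ (b' * u * N a)); last by rewrite ler_wpM2r //; lra.
  by rewrite -mulrA ler_wpM2l // mulrC; case: (Nle a).
have [s [ss s1 snet]] := exists_half_net N0 ND NZ (ltn0Sn _) N_le le_N.
have BS : (B <= S)%MS by rewrite eq_row_base.
exists [seq a *m B | a <- s]; split; first by rewrite size_map.
  move=> _ /mapP[a /s1 + ->]; rewrite NE !mul1r => /andP[h1 h2].
  by split => //; apply: submx_trans BS; exact: submxMl.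
move=> y yS y2 yi; have /submxP[a ya] : (y <= B)%MS by rewrite eq_row_base.
have /snet[c cs] : N a <= 1 by rewrite NE -ya !mul1r y2.
rewrite NE mulmxBl -ya => /andP[h _].
by exists (c *m B); [exact: map_f | rewrite mulrC -[2^-1]mul1r].
Qed.

(** * Independence and Bernstein's inequality *)

Section weighted_integral.
Local Open Scope ereal_scope.
Context d (T : measurableType d) (R : realType) (mu : {measure set T -> \bar R}).
Context (h : T -> \bar R) (mh : measurable_fun setT h) (h0 : forall w, 0 <= h w).
Context (hfin : forall w, h w \is a fin_num).
Context (X : T -> R) (mX : measurable_fun setT X).
Context (C : \bar R) (Cfin : C \is a fin_num).
Context (hC : forall B : set R, measurable B ->
  \int[mu]_w (h w * (\1_B (X w))%:E) = C * mu (X @^-1` B)).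

Import HBNNSimple.

(** By linearity, since [g] is a finite combination of indicators of its level sets, to which [hC]
    applies. *)
Let integral_weight_nnsfun (g : {nnsfun R >-> R}) :
  \int[mu]_w (h w * (g (X w))%:E) = C * \int[mu]_w (g (X w))%:E.
Proof.
have mI r : measurable_fun [set: T] (fun w => (\1_(g @^-1` [set r]) (X w))%:E : \bar R).
  apply/measurable_EFinP; apply: measurableT_comp mX.
  by apply: measurable_indic; exact: measurable_sfunP.
have r0 w r : 0 <= (r * \1_(g @^-1` [set r]) (X w))%:E.
  by rewrite EFinM nnfun_muleindic_ge0.
have mrI r : measurable_fun [set: T]
    (fun w => (r * \1_(g @^-1` [set r]) (X w))%:E : \bar R).
  by under eq_fun do rewrite EFinM; apply: emeasurable_funM.
under eq_integral do rewrite fimfunE -fsumEFin // ge0_mule_fsumr //.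
rewrite ge0_integral_fsum //; last 2 first.
- by move=> r; exact: emeasurable_funM.
- by move=> r w _; rewrite mule_ge0.
under [in RHS]eq_integral do rewrite fimfunE -fsumEFin //.
rewrite ge0_integral_fsum // ge0_mule_fsumr; last first.
  by move=> r; apply: integral_ge0.
apply: eq_fsbigr => r /[!inE] -[x _ gx].
have rge0 : (0 <= r)%R by rewrite -gx.
under eq_integral do rewrite EFinM muleCA.
rewrite ge0_integralZl //; last 2 first.
- exact: emeasurable_funM.
- by move=> w _; rewrite mule_ge0 // lee_fin indicE.
rewrite hC; last exact: measurable_sfunP.
under [in RHS]eq_integral do rewrite EFinM.
rewrite ge0_integralZl //.
rewrite muleCA; congr (_ * (_ * _)).
rewrite -[in LHS](setIT (X @^-1` _)) -integral_indic //.
by rewrite -[X in measurable X]setTI; apply: mX => //; exact: measurable_sfunP.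
Qed.

(** Monotone convergence along simple approximations of [f]. It serves to replace an indicator of
    one variable by a general function when independence is extended factor by factor. *)
Lemma ge0_integral_weight (f : R -> \bar R) : measurable_fun setT f ->
  (forall r, 0 <= f r) ->
  \int[mu]_w (h w * f (X w)) = C * \int[mu]_w f (X w).
Proof.
move=> mf f0; pose g := nnsfun_approx measurableT mf.
have gcvg w : (EFin \o (fun k => g k (X w))) @ \oo --> f (X w).
  by apply: cvg_nnsfun_approx.
have mg k : measurable_fun setT (fun w => (g k (X w))%:E : \bar R).
  by apply/measurable_EFinP; apply: measurableT_comp mX.
have gnd w a b : (a <= b)%N -> (g a (X w) <= g b (X w))%R.
  by move=> ab; exact/lefP/nd_nnsfun_approx.
have cvg1 : \int[mu]_w (h w * (g k (X w))%:E) @[k --> \oo] -->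
    \int[mu]_w (h w * f (X w)).
  rewrite (_ : (fun w => h w * f (X w)) =
               (fun w => limn (fun k => h w * (g k (X w))%:E))); last first.
    by apply/funext => w; apply/esym/cvg_lim => //; apply: cvgeZl => //; exact: gcvg.
  apply: cvg_monotone_convergence => //.
  - by move=> k; exact: emeasurable_funM.
  - by move=> k w _; rewrite mule_ge0 // lee_fin.
  - by move=> w _ a b ab; rewrite lee_wpmul2l // lee_fin gnd.
have cvg2 : \int[mu]_w (h w * (g k (X w))%:E) @[k --> \oo] -->
    C * \int[mu]_w (f (X w)).
  under eq_cvg do rewrite integral_weight_nnsfun.
  apply: cvgeZl => //.
  rewrite (_ : (fun w => f (X w)) = (fun w => limn (fun k => (g k (X w))%:E))).
    apply: cvg_monotone_convergence => //.
    - by move=> k w _; rewrite lee_fin.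
    - by move=> w _ a b ab; rewrite lee_fin gnd.
  by apply/funext => w; apply/esym/cvg_lim => //; exact: gcvg.
exact: (cvg_unique _ cvg1 cvg2).
Qed.

End weighted_integral.


Section independent_product.
Context d (T : measurableType d) (R : realType) (P : probability T R) (n : nat).
Context (X : 'I_n -> {RV P >-> R}).
Context (hind : mutually_independent P (fun i => X i)).
Local Open Scope ereal_scope.

(** Induction on the list of factors that may fail to be indicators. With indicators only, the claim
    is the definition of independence. To free factor [i], the product of the others serves as
    weight [h], and the induction hypothesis, with an indicator in place [i], supplies [hC]. *)
Let integral_prod_partial (s : seq 'I_n) : uniq s -> forall f : 'I_n -> R -> R,
  (forall i, measurable_fun setT (f i)) -> (forall i r, (0 <= f i r)%R) ->
  (forall i, \int[P]_w (f i (X i w))%:E \is a fin_num) ->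
  (forall i, i \notin s -> exists2 B, measurable B & f i = \1_B) ->
  \int[P]_w (\prod_(i < n) f i (X i w))%:E = \prod_(i < n) \int[P]_w (f i (X i w))%:E.
Proof.
have mX i : measurable_fun setT (X i) by exact: measurable_funPT.
have mXB i B : measurable B -> measurable (X i @^-1` B).
  by move=> mB; rewrite -[X in measurable X]setTI; exact: mX.
elim: s => [_ f mf f0 ffin find|i s IH /= /andP[si us] f mf f0 ffin find].
  have /choice[B hB] : forall i, exists B, measurable B /\ f i = \1_B.
    by move=> i; have [//|B ? ?] := find i; exists B.
  have mB i : measurable (B i) by case: (hB i).
  have fB i : f i = \1_(B i) by case: (hB i).
  transitivity (\int[P]_w (\1_(\bigcap_(i in [set: 'I_n]) (X i @^-1` B i)) w)%:E).
    apply: eq_integral => w _; congr EFin.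
    rewrite [RHS]indicE; have [/set_mem h|/negP h] := boolP (_ \in _).
      rewrite big1 // => i _; rewrite fB indicE mem_set //; exact: h.
    have [i hi] : exists i, ~ B i (X i w).
      apply/existsNP => h'; apply: h; apply/mem_set => i _; exact: h'.
    by rewrite (bigD1 i) //= fB indicE memNset // mul0r.
  rewrite integral_indic ?setIT //; last first.
    by apply: fin_bigcap_measurable => // i _; exact: mXB.
  rewrite [LHS](hind mB); apply: eq_bigr => i _.
  rewrite fB -[in LHS](setIT (X i @^-1` _)) -integral_indic //; exact: mXB.
pose h w := (\prod_(j < n | j != i) f j (X j w))%:E : \bar R.
pose C := \prod_(j < n | j != i) \int[P]_w (f j (X j w))%:E.
have int0 j : 0 <= \int[P]_w (f j (X j w))%:E.
  by apply: integral_ge0 => w _; rewrite lee_fin.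
transitivity (\int[P]_w (h w * (EFin \o f i) (X i w))).
  by apply: eq_integral => w _; rewrite (bigD1 i) //= mulrC.
rewrite (bigD1 i) //= -/C muleC.
apply: (@ge0_integral_weight _ _ _ P h _ _ _ (X i) _ C _ _ (EFin \o f i)).
- apply/measurable_EFinP; under eq_fun do rewrite big_mkcond.
  apply: measurable_prod => j _; case: (j != i); first exact: measurableT_comp.
  exact: measurable_cst.
- by move=> w; rewrite lee_fin; apply: prodr_ge0.
- by [].
- exact: mX.
- by apply: (big_ind (fun x : \bar R => x \is a fin_num)) => // a b ha hb; rewrite fin_numM.
- move=> B mB.
  pose f' j := if j == i then \1_B : R -> R else f j.
  have f'i : f' i = \1_B by rewrite /f' eqxx.
  have f'ne j : j != i -> f' j = f j by rewrite /f' => /negbTE ->.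
  have intB : \int[P]_w (\1_B (X i w))%:E = P (X i @^-1` B).
    by rewrite -[in RHS](setIT (X i @^-1` _)) -integral_indic //; exact: mXB.
  have := IH us f'; rewrite (bigD1 i) //= f'i intB muleC.
  under eq_bigr => j ji do rewrite f'ne //.
  rewrite -/C => <-.
  + apply: eq_integral => w _; rewrite (bigD1 i) //= f'i mulrC EFinM; congr (_%:E * _).
    by apply: eq_bigr => j ji; rewrite f'ne.
  + move=> j; rewrite /f'; case: ifP => _ //; exact: measurable_indic.
  + by move=> j r; rewrite /f'; case: ifP => _ //; rewrite indicE.
  + move=> j; rewrite /f'; case: eqP => [->|_] //.
    by rewrite intB fin_num_measure //; exact: mXB.
  + move=> j js; rewrite /f'; case: eqP => [_|/eqP ji]; first by exists B.
    by apply: find; rewrite inE negb_or ji.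
- exact/measurable_EFinP.
- by move=> r; rewrite lee_fin.
Qed.

Lemma integral_prod_independent (f : 'I_n -> R -> R) :
  (forall i, measurable_fun setT (f i)) -> (forall i r, (0 <= f i r)%R) ->
  (forall i, \int[P]_w (f i (X i w))%:E \is a fin_num) ->
  \int[P]_w (\prod_(i < n) f i (X i w))%:E = \prod_(i < n) \int[P]_w (f i (X i w))%:E.
Proof.
move=> mf f0 ffin; apply: (integral_prod_partial (enum_uniq 'I_n)) => // i.
by rewrite mem_enum.
Qed.

End independent_product.

Lemma measurable_dotR_rvec d (T : measurableType d) (R : realType) (n : nat)
  (X : 'I_n -> T -> R) (t : 'rV[R]_n) : (forall i, measurable_fun setT (X i)) ->
  measurable_fun setT (fun w => dotR t (rvec X w)).
Proof.
move=> mX; apply: measurable_sum => i.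
by under eq_fun do rewrite mxE; apply: measurable_funM.
Qed.

Section bernstein.
Context d (T : measurableType d) (R : realType) (P : probability T R) (n : nat).
Context (xi : 'I_n -> {RV P >-> R}).
Context (hind : mutually_independent P (fun i => xi i)).
Context (sigma c : R) (hc : 0 < c).
Context (hmgf : forall (i : 'I_n) (lam : R), - c^-1 < lam < c^-1 ->
     ('E_P[fun w => expR (lam * xi i w)] <=
      (expR (lam ^+ 2 * sigma ^+ 2 / (2 * (1 - `|lam| * c))))%:E)%E).
Local Notation Xi w := (rvec (fun i => xi i : T -> R) w).

(** Independence factorises the expectation. As |lam t_i| c <= lam b < 1 for every [i], all
    denominators can be replaced by the common 1 - lam b, and the exponents then sum to a multiple
    of |t|_2^2. *)
Lemma mgf_dotR_le (t : 'rV[R]_n) (lam b : R) : 0 <= lam ->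
  c * norminf t <= b -> lam * b < 1 ->
  ('M_P (fun w => dotR t (Xi w)) lam <=
   (expR (lam ^+ 2 * (sigma ^+ 2 * norm2 t ^+ 2) / (2 * (1 - lam * b))))%:E)%E.
Proof.
move=> lam0 tb lamb.
have ltc i : `|lam * t 0 i| * c <= lam * b.
  rewrite normrM (ger0_norm lam0) -mulrA ler_wpM2l // (le_trans _ tb) // mulrC.
  by rewrite ler_pM2l // le_norminf.
have lt1 i : - c^-1 < lam * t 0 i < c^-1.
  by rewrite -ltr_norml -[c^-1]mul1r ltr_pdivlMr // (le_lt_trans (ltc i)).
have E1 i : (\int[P]_w (expR (lam * t 0 i * xi i w))%:E <=
   (expR (lam ^+ 2 * sigma ^+ 2 * t 0 i ^+ 2 / (2 * (1 - lam * b))))%:E)%E.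
  have := hmgf i (lt1 i); rewrite unlock => /le_trans; apply.
  rewrite lee_fin ler_expR exprMn.
  have -> : lam ^+ 2 * t 0 i ^+ 2 * sigma ^+ 2 = lam ^+ 2 * sigma ^+ 2 * t 0 i ^+ 2 by ring.
  rewrite ler_wpM2l -?exprMn ?sqr_ge0 // lef_pV2 ?posrE ?mulr_gt0 ?subr_gt0 //.
    by rewrite ler_pM2l // lerD2l lerN2.
  exact: le_lt_trans (ltc i) lamb.
have E0 i : (0 <= \int[P]_w (expR (lam * t 0 i * xi i w))%:E)%E.
  by apply: integral_ge0 => w _; rewrite lee_fin expR_ge0.
rewrite /mmt_gen_fun unlock.
rewrite [X in (X <= _)%E](_ : _ =
    \int[P]_w (\prod_(i < n) expR (lam * t 0 i * xi i w))%:E)%E; last first.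
  apply: eq_integral => w _ /=; rewrite -expR_sum; congr (expR _)%:E.
  by rewrite /dotR mulr_suml; apply: eq_bigr => i _; rewrite mxE; ring.
rewrite (integral_prod_independent hind (f := fun i r => expR (lam * t 0 i * r))).
- apply: (@le_trans _ _ (\prod_(i < n)
    (expR (lam ^+ 2 * sigma ^+ 2 * t 0 i ^+ 2 / (2 * (1 - lam * b))))%:E)%E).
    (* Comparing products needs nonnegative factors, so nonnegativity is carried along in the
       induction. *)
    apply: (@proj2 (0 <= \prod_(i < n) \int[P]_w (expR (lam * t 0 i * xi i w))%:E)%E).
    by elim/big_ind2: _ => // a a' e e' [a0 aa'] [e0 ee']; rewrite mule_ge0 // lee_pmul.
  rewrite prodEFin lee_fin -expR_sum ler_expR sqr_norm2 /dotR -mulr_suml -mulr_sumr.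
  by rewrite mulrA.
- by move=> i; apply: measurableT_comp => //; exact: measurable_funM.
- by move=> i r; exact: expR_ge0.
- by move=> i; rewrite ge0_fin_numE // (le_lt_trans (E1 i)) ?ltry.
Qed.

Lemma bernstein_dotR (t : 'rV[R]_n) (V b w0 : R) : 0 < V -> 0 < w0 ->
  sigma ^+ 2 * norm2 t ^+ 2 <= V -> c * norminf t <= b ->
  (P [set w | (w0 <= dotR t (Xi w))%R] <= (expR (- (w0 ^+ 2 / (2 * (V + b * w0)))))%:E)%E.
Proof.
move=> V0 w00 tV tb.
have b0 : 0 <= b by rewrite (le_trans _ tb) // mulr_ge0 ?norminf_ge0 // ltW.
have D0 : 0 < V + b * w0 by rewrite ltr_pwDl // mulr_ge0 // ltW.
(* With this choice 1 - lam b = V / (V + b w0), so the Chernoff exponent becomes lam^2 (V + b w0) /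
   2 - lam w0 = - w0^2 / (2 (V + b w0)). *)
pose lam := w0 / (V + b * w0).
have lam0 : 0 < lam by rewrite divr_gt0.
have lamb : lam * b < 1.
  by rewrite /lam mulrAC ltr_pdivrMr // mul1r mulrC ltrDr.
have mY : measurable_fun setT (fun w => dotR t (Xi w)).
  by apply: measurable_dotR_rvec => i; exact: measurable_funPT.
pose Y : {RV P >-> R} := HB.pack (fun w => dotR t (Xi w)) (isMeasurableFun.Build _ _ _ _ _ mY).
apply: le_trans (chernoff Y w0 lam0) _.
have := mgf_dotR_le (ltW lam0) tb lamb.
move=> /(lee_wpmul2r (x := (expR (- (lam * w0)))%:E)) /le_trans; apply.
  by rewrite lee_fin expR_ge0.
rewrite -EFinM lee_fin -expRD ler_expR.
have -> : 1 - lam * b = V / (V + b * w0) by rewrite /lam; field; rewrite gt_eqF.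
apply: (@le_trans _ _ (lam ^+ 2 * V / (2 * (V / (V + b * w0))) - lam * w0)).
  have q0 : 0 < V / (V + b * w0) by rewrite divr_gt0.
  rewrite lerD2r ler_pM2r ?invr_gt0 ?(mulr_gt0 _ q0) //.
  by rewrite ler_wpM2l // sqr_ge0.
rewrite le_eqVlt; apply/orP; left; apply/eqP; rewrite /lam; field.
by rewrite !gt_eqF.
Qed.

End bernstein.

(** * Tail bounds *)

Lemma union_bound d (T : measurableType d) (R : realType)
  (mu : {measure set T -> \bar R}) (I : eqType) (s : seq I) (F : I -> set T)
  (E : set T) (r : R) :
  measurable E -> (forall t, measurable (F t)) ->
  (forall w, E w -> exists2 t, t \in s & F t w) ->
  (forall t, t \in s -> (mu (F t) <= r%:E)%E) ->
  (mu E <= ((size s)%:R * r)%:E)%E.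
Proof.
move=> + mF; elim: s E => [|a s IH] E mE Es Fr.
  rewrite (_ : E = set0) ?measure0 ?mul0r //.
  by apply/seteqP; split => // w /Es[].
have -> : E = (E `&` F a) `|` (E `\` F a) by rewrite setUIDK.
have mEa : measurable (E `&` F a) by exact: measurableI.
have mED : measurable (E `\` F a) by exact: measurableD.
apply: le_trans (measureU2 _ mEa mED) _.
rewrite /= -nat1r mulrDl mul1r EFinD; apply: leeD.
  apply: (le_trans _ (Fr a (mem_head _ _))).
  by apply: le_measure; rewrite ?inE //; exact: subIsetr.
apply: IH => // [w [/Es[t]]|t ts]; last by apply: Fr; rewrite inE ts orbT.
by rewrite inE => /predU1P[->//|ts Ft _]; exists t.
Qed.

Section projected_vector.
Context d (T : measurableType d) (R : realType) (m n : nat) (S : 'M[R]_(m, n)).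
Context (X : 'I_n -> T -> R) (mX : forall i, measurable_fun setT (X i)).
Local Notation Y w := (projS S (rvec X w)).

(** Self-adjointness turns the coordinate into the linear form <P e_i, X>, with a fixed coefficient
    vector. *)
Lemma measurable_projS_entry (i : 'I_n) : measurable_fun setT (fun w => Y w 0 i).
Proof.
under eq_fun do rewrite -dotR_canon projS_selfadjoint dotRC.
exact: measurable_dotR_rvec.
Qed.

Lemma measurable_norminf_projS : measurable_fun setT (fun w => norminf (Y w)).
Proof.
rewrite /norminf; elim: (index_enum _) => [|i s IH].
  by under eq_fun do rewrite big_nil; exact: measurable_cst.
under eq_fun do rewrite big_cons.
apply: measurable_maxr => //; apply: measurableT_comp => //.
exact: measurable_projS_entry.
Qed.

Lemma measurable_sqr_norm2_projS : measurable_fun setT (fun w => norm2 (Y w) ^+ 2).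
Proof.
under eq_fun do rewrite sqr_norm2.
apply: measurable_sum => i.
by apply: measurable_funM; exact: measurable_projS_entry.
Qed.

End projected_vector.

Lemma measurable_set_ge d (T : measurableType d) (R : realType) (f : T -> R) (r : R) :
  measurable_fun setT f -> measurable [set w | r <= f w].
Proof.
move=> mf; rewrite (_ : mkset _ = setT `&` f @^-1` [set` `[r, +oo[]); first exact: mf.
by apply/seteqP; split => w /=; rewrite in_itv /= andbT // => -[].
Qed.

Lemma measurable_set_le d (T : measurableType d) (R : realType) (f : T -> R) (r : R) :
  measurable_fun setT f -> measurable [set w | f w <= r].
Proof.
move=> mf; rewrite (_ : mkset _ = setT `&` f @^-1` [set` `]-oo, r]]); first exact: mf.
by apply/seteqP; split => w /=; rewrite in_itv /= // => -[].
Qed.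

(** From 10 = 1 + 9 <= exp(9). *)
Lemma expn10_le_expR (R : realType) (D : nat) : (10 ^ D)%:R <= expR (9 * D%:R) :> R.
Proof.
rewrite natrX mulrC expRM_natl; apply: lerXn2r; rewrite ?nnegrE ?expR_ge0 //.
by have := expR_ge1Dx (9 : R); lra.
Qed.

Section tail_bounds.
Context d (T : measurableType d) (R : realType) (P : probability T R) (n : nat).
Context (xi : 'I_n -> {RV P >-> R}).
Context (hind : mutually_independent P (fun i => xi i)).
Context (sigma c : R) (hsigma : 0 < sigma) (hc : 0 < c).
Context (hmgf : forall (i : 'I_n) (lam : R), - c^-1 < lam < c^-1 ->
     ('E_P[fun w => expR (lam * xi i w)] <=
      (expR (lam ^+ 2 * sigma ^+ 2 / (2 * (1 - `|lam| * c))))%:E)%E).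
Context (m : nat) (S : 'M[R]_(m, n)).
Local Notation Xi w := (rvec (fun i => xi i : T -> R) w).

Let mxi i : measurable_fun setT (xi i).
Proof. exact: measurable_funPT. Qed.

Lemma norm2_projS_tail (x u : R) : 0 < x -> 0 < u ->
  (P [set w | (18 ^+ 2 * (sigma ^+ 2 + 2 * c * u / 18) * ((\rank S)%:R + x)
                   <= norm2 (projS S (Xi w)) ^+ 2)%R
              /\ (norminf (projS S (Xi w)) <= u)%R]
      <= (expR (- x))%:E)%E.
Proof.
move=> x0 u0; set D := \rank S.
have cu : 0 < c * u by rewrite mulr_gt0.
have s2 : 0 < sigma ^+ 2 by rewrite exprn_gt0.
have Dx : 0 < D%:R + x by rewrite ltr_wpDl.
set q : R := 18 ^+ 2 * (sigma ^+ 2 + 2 * c * u / 18) * (D%:R + x).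
have qE : q = 36 * (9 * sigma ^+ 2 + c * u) * (D%:R + x) by rewrite /q; field.
have q0 : 0 < q by rewrite qE !mulr_gt0 // addr_gt0 // mulr_gt0.
pose z := Num.sqrt q.
have z0 : 0 < z by rewrite sqrtr_gt0.
have z2 : z ^+ 2 = q by rewrite sqr_sqrtr // ltW.
have [s [ss sS snet]] := subspace_half_net S z0 u0.
pose F (t : 'rV[R]_n) := [set w | q / 2 <= dotR t (Xi w)].
have mF t : measurable (F t).
  by apply: measurable_set_ge; exact: measurable_dotR_rvec.
apply: le_trans (@union_bound _ _ _ P _ s F _ (expR (- (9 * (D%:R + x)))) _ mF _ _) _.
- apply: measurableI; [apply: measurable_set_ge|apply: measurable_set_le].
    exact: measurable_sqr_norm2_projS.
  exact: measurable_norminf_projS.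
- move=> w [/= Yq Yu]; set Y := projS S (Xi w) in Yq Yu.
  have zY : z <= norm2 Y by rewrite -ler_sqr ?nnegrE ?norm2_ge0 ?(ltW z0) // z2.
  have Y0 : 0 < norm2 Y := lt_le_trans z0 zY.
  (* The scaling factor is at most 1 on the event, so the bound [u] on the sup norm survives. *)
  pose y := (z / norm2 Y) *: Y.
  have k0 : 0 < z / norm2 Y by rewrite divr_gt0.
  have k1 : z / norm2 Y <= 1 by rewrite ler_pdivrMr // mul1r.
  have YS : (Y <= S)%MS := projS_sub S (Xi w).
  have y2 : norm2 y = z by rewrite norm2Z gtr0_norm // divfK ?gt_eqF.
  have [t ts ty] : exists2 t, t \in s & norm2 (y - t) <= z / 2.
    apply: snet; [exact: scalemx_sub | by rewrite y2 |].
    rewrite norminfZ gtr0_norm // (le_trans _ Yu) // ler_piMl ?norminf_ge0 //.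
  exists t => //; have [tS _ _] := sS t ts.
  rewrite /F /= dotRC -(dotR_projSl _ tS) -/Y dotRC.
  have -> : t = y - (y - t) by rewrite subKr.
  rewrite dotRBl.
  have h1 : dotR y Y = z * norm2 Y.
    by rewrite dotRZl -sqr_norm2 expr2 mulrA divfK ?gt_eqF.
  have h2 : dotR (y - t) Y <= z / 2 * norm2 Y.
    by apply: le_trans (dotR_le_norm2 _ _) _; rewrite ler_wpM2r ?norm2_ge0.
  have h3 : q <= z * norm2 Y by rewrite -z2 expr2 ler_wpM2l // ltW.
  by rewrite h1; lra.
- move=> t ts; have [tS t2 ti] := sS t ts.
  apply: le_trans (bernstein_dotR hind hc hmgf (V := sigma ^+ 2 * q) (b := c * u) _ _ _ _) _.
  + by rewrite mulr_gt0.
  + by rewrite divr_gt0.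
  + by rewrite ler_pM2l // -z2 ler_sqr ?nnegrE ?norm2_ge0 // ltW.
  + by rewrite ler_pM2l.
  rewrite lee_fin ler_expR lerN2.
  (* The exponent must reach 9 (D + x). Since 9 (8 sigma^2 + 4 c u) = 72 sigma^2 + 36 c u while q =
     (324 sigma^2 + 36 c u)(D + x), the c u terms match exactly and the sigma^2 term has slack. *)
  have -> : (q / 2) ^+ 2 / (2 * (sigma ^+ 2 * q + c * u * (q / 2))) =
      q / (8 * sigma ^+ 2 + 4 * (c * u)).
    have sq := mulr_gt0 s2 q0; have cq := mulr_gt0 cu q0.
    by field; rewrite !gt_eqF //; lra.
  rewrite ler_pdivlMr; last by lra.
  by rewrite qE; have := mulr_gt0 s2 Dx; lra.
rewrite lee_fin; apply: (@le_trans _ _ (expR (9 * D%:R) * expR (- (9 * (D%:R + x))))).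
  rewrite ler_wpM2r ?expR_ge0 // (le_trans _ (expn10_le_expR _ _)) //.
  by rewrite ler_nat.
by rewrite -expRD ler_expR; lra.
Qed.

Lemma norminf_projS_tail (x : R) : 0 < x ->
  (P [set w | (x <= norminf (projS S (Xi w)))%R]
   <= (2 * n%:R * expR (- (x ^+ 2 / (2 * Lambda2 S ^+ 2 * (sigma ^+ 2 + c * x)))))%:E)%E.
Proof.
move=> x0; set L := Lambda2 S.
have s2 : 0 < sigma ^+ 2 by rewrite exprn_gt0.
pose r i := projS S (Defs.canon i : 'rV[R]_n).
pose s := [seq r i | i <- enum 'I_n] ++ [seq - r i | i <- enum 'I_n].
have -> : 2 * n%:R = (size s)%:R :> R.
  by rewrite size_cat !size_map -enumT size_enum_ord addnn -mul2n natrM.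
pose F (t : 'rV[R]_n) := [set w | x <= dotR t (Xi w)].
have mF t : measurable (F t).
  by apply: measurable_set_ge; exact: measurable_dotR_rvec.
apply: (@union_bound _ _ _ P _ s F) => //.
- by apply: measurable_set_ge; exact: measurable_norminf_projS.
- move=> w /= xY.
  (* The maximum defining [norminf] has default 0, so 0 < x ensures that some coordinate attains the
     level. *)
  have [i hi] : exists i, x <= `|projS S (Xi w) 0 i|.
    apply: contrapT => /forallNP h.
    suff : norminf (projS S (Xi w)) < x by rewrite ltNge xY.
    by apply/bigmax_ltP; split=> // i _; rewrite ltNge; apply/negP.
  have ri : dotR (r i) (Xi w) = projS S (Xi w) 0 i.
    by rewrite /r projS_selfadjoint dotRC dotR_canon.
  move: hi; rewrite ler_normr => /orP[hi|hi].
    exists (r i); last by rewrite /F /= ri.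
    by rewrite mem_cat; apply/orP; left; apply: map_f; rewrite mem_enum.
  exists (- r i); last by rewrite /F /= dotRNl ri.
  rewrite mem_cat; apply/orP; right.
  by apply: (map_f (fun i => - r i)); rewrite mem_enum.
- move=> t ts.
  have [t2 ti] : norm2 t <= L /\ norminf t <= L ^+ 2.
    move: ts; rewrite mem_cat => /orP[] /mapP[i _ ->].
      split; first exact: norm2_projS_canon_le_Lambda2.
      by apply: norminf_le => [|j]; rewrite ?sqr_ge0 // projS_canon_entry_le.
    split; first by rewrite norm2N norm2_projS_canon_le_Lambda2.
    apply: norminf_le => [|j]; rewrite ?sqr_ge0 // mxE normrN.
    exact: projS_canon_entry_le.
  (* For L = 0 division by zero returns 0, so the bound reads exp(0) = 1; Bernstein's inequality
     requires a positive variance term. *)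
  have [L0|L0] := eqVneq L 0.
    rewrite L0 expr0n /= mulr0 mul0r invr0 mulr0 oppr0 expR0.
    exact: probability_le1.
  have Lpos : 0 < L by rewrite lt_neqAle eq_sym L0 Lambda2_ge0.
  (* Bernstein's inequality is used with V = sigma^2 L^2 and b = c L^2; the bound L^2 on the entries
     is what lets L^2 factor out of both terms. *)
  have -> : 2 * L ^+ 2 * (sigma ^+ 2 + c * x) =
      2 * (sigma ^+ 2 * L ^+ 2 + c * L ^+ 2 * x) by ring.
  apply: (bernstein_dotR hind hc hmgf) => //.
  + by rewrite mulr_gt0 // exprn_gt0.
  + by rewrite ler_pM2l // ler_sqr ?nnegrE ?norm2_ge0 // ltW.
  + by rewrite ler_pM2l.
Qed.

End tail_bounds.

Theorem mainTheorem3 (R : realType) (n : nat) (hn : (2 <= n)%N) (m D : nat)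
  (S : 'M[R]_(m, n)) (hD : \rank S = D)
  (d : measure_display) (T : measurableType d)
  (P : probability T R) (xi : 'I_n -> {RV P >-> R})
  (hind : mutually_independent P (fun i => xi i))
  (sigma c : R) (hsigma : 0 < sigma) (hc : 0 < c)
  (hmgf : forall (i : 'I_n) (lam : R), - c^-1 < lam < c^-1 ->
     ('E_P[fun w => expR (lam * xi i w)] <=
      (expR (lam ^+ 2 * sigma ^+ 2 / (2 * (1 - `|lam| * c))))%:E)%E) :
  let kappa : R := 18 in
  (forall x u : R, 0 < x -> 0 < u ->
     (P [set w | (kappa ^+ 2 * (sigma ^+ 2 + 2 * c * u / kappa) * (D%:R + x)
                   <= norm2 (projS S (rvec (fun i => xi i) w)) ^+ 2)%R
              /\ (norminf (projS S (rvec (fun i => xi i) w)) <= u)%R]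
      <= (expR (- x))%:E)%E) /\
  (forall x : R, 0 < x ->
     (P [set w | (x <= norminf (projS S (rvec (fun i => xi i) w)))%R]
      <= (2 * n%:R * expR (- (x ^+ 2 / (2 * Lambda2 S ^+ 2 * (sigma ^+ 2 + c * x)))))%:E)%E).
Proof.
split=> [x u x0 u0|x x0]; last exact: norminf_projS_tail.
by rewrite -hD; exact: norm2_projS_tail.
Qed.
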